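(* Let $Q$ be a prime power, let $r$ be a positive integer, and let $\beta$ be a $(Q+1)$-th root of unity in $\mathbb{F}_{Q^2}$. Let $h(x)\in\mathbb{F}_{Q^2}[x]$ be a polynomial of degree $d$ such that $h(0)\ne 0$ and \[ \left(x^d \cdot h(1/x)\right)^Q=\beta \cdot h(x^Q) \] as polynomials. Then $f(x):=x^r h(x^{Q-1})$ permutes $\mathbb{F}_{Q^2}$ if and only if all of the following hold: (1) $\gcd(r,Q-1)=1$; (2) $\gcd(r-d,Q+1)=1$; (3) $h(x)$ has no roots in $\mu_{Q+1}$.
   Context: $\mu_{Q+1}$ denotes the set of $(Q+1)$-th roots of unity in an algebraic closure of $\mathbb{F}_Q$. A polynomial $f$ permutes $\mathbb{F}_{Q^2}$ if $\alpha\mapsto f(\alpha)$ is a bijection of $\mathbb{F}_{Q^2}$. *)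

(* Defs.v *)
From HB Require Import structures.
From mathcomp Require Import all_boot all_order all_algebra all_field.

Set Implicit Arguments.
Unset Strict Implicit.
Unset Printing Implicit Defensive.

Import GRing.Theory.
Local Open Scope ring_scope.

Definition prime_power (q : nat) : Prop :=
  exists p k : nat, [/\ prime p, (0 < k)%N & q = (p ^ k)%N].

(* The polynomial x^d * h(1/x), for h of degree at most d: recip_polyE states
   this identity in the field of rational functions. *)
Definition recip_poly (R : nzRingType) (d : nat) (h : {poly R}) : {poly R} :=
  \sum_(i < d.+1) h`_i *: 'X^(d - i).

Lemma recip_polyE (F : fieldType) (d : nat) (h : {poly F}) :
    (size h <= d.+1)%N ->
  let x := tofrac ('X : {poly F}) in
  tofrac (recip_poly d h) = x ^+ d * (map_poly (@tofrac _ \o polyC) h).[x^-1].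
Proof.
move=> szh x; have X0 : x != 0 by rewrite tofrac_eq0 polyX_eq0.
rewrite (@horner_coef_wide _ d.+1) ?(leq_trans (size_poly _ _)) //.
rewrite mulr_sumr rmorph_sum; apply: eq_bigr => i _ /=.
rewrite coef_map /= -mul_polyC rmorphM rmorphXn /= mulrCA; congr (_ * _).
by rewrite exprVn expfB_cond // (negPf X0) add0n -ltnS.
Qed.

Definition permutes (F : finFieldType) (f : {poly F}) : Prop :=
  bijective (fun a : F => f.[a]).

Definition algebraic_closure (F : fieldType) (K : closedFieldType)
    (iota : {rmorphism F -> K}) : Prop :=
  forall x : K, algebraicOver iota x.

(* Main.v *)
(** For [a <> 0] put [z = a ^ (Q - 1)], which runs over all of mu_(Q+1).  The
    self-reciprocity of [h] says that [h(z) ^ Q * z ^ d = beta * h(z)] on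
    mu_(Q+1), so that [f(a) ^ (Q - 1) = beta * z ^ (r - d)] unless [h(z) = 0].
    Hence [f] covers the map [z |-> beta * z ^ (r - d)] of mu_(Q+1), which is
    injective iff [r - d] is prime to [Q + 1], and on each fibre of
    [a |-> a ^ (Q - 1)], a coset of F_Q^*, it is a multiple of [a |-> a ^ r],
    which is injective iff [r] is prime to [Q - 1]. *)

Require Import Defs.
From HB Require Import structures.
From mathcomp Require Import all_boot all_order all_algebra all_field.
From mathcomp Require Import cyclic.

Import GRing.Theory.
Local Open Scope ring_scope.

Lemma finField_prim_root (F : finFieldType) :
  exists w : F, (#|F|.-1).-primitive_root w.
Proof.
have cF : (1 < #|F|)%N := finNzRing_gt1 F.
have sz : size (enum [pred x : F | x != 0]) = #|F|.-1.
  by rewrite -cardE -(cardC1 (0 : F)); apply: eq_card => x; rewrite !inE.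
have n0 : (0 < #|F|.-1)%N by rewrite -ltnS prednK // ltnW.
have [|||w _ pw] :=
  hasP (@has_prim_root F _ (enum [pred x : F | x != 0]) n0 _ _ _).
- apply/allP => x; rewrite mem_enum inE => x0; apply/unity_rootP.
  by apply: (mulfI x0); rewrite -exprS prednK ?expf_card ?mulr1 // ltnW.
- exact: enum_uniq.
- by rewrite sz.
by exists w.
Qed.

Lemma prim_root1 (R : nzRingType) (n : nat) :
  n.-primitive_root (1 : R) -> n = 1%N.
Proof.
by move=> p1; apply/eqP; rewrite -dvdn1 (prim_order_dvd p1) expr1n.
Qed.

Lemma expr_coprime_eq1 (R : nzRingType) (x : R) (m n : nat) :
  coprime m n -> x ^+ m = 1 -> x ^+ n = 1 -> x = 1.
Proof.
case: m => [|m] co xm xn.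
  by move: co xn; rewrite /coprime gcd0n => /eqP->.
have [a _] := Bezoutl n (ltn0Sn m).
rewrite (eqP co) => /dvdnP[k Dk].
have: x ^+ (1 + a * n) = 1 by rewrite Dk mulnC exprM xm expr1n.
by rewrite exprD mulnC exprM xn expr1n mulr1.
Qed.

(** The preimage is [c ^+ u], where [u] inverts [r] modulo [n]. *)
Lemma expr_coprime_surj (R : nzRingType) (c : R) (r n : nat) :
  (0 < r)%N -> coprime r n -> c ^+ n = 1 -> exists2 e, e ^+ n = 1 & e ^+ r = c.
Proof.
move=> r0 /(coprimeP _ r0)[[u v] /= uv] cn; exists (c ^+ u).
  by rewrite -exprM mulnC exprM cn expr1n.
have -> : c ^+ u ^+ r = c ^+ (v * n + 1).
  by rewrite -exprM -uv subnKC // ltnW // -subn_gt0 uv.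
by rewrite exprD mulnC exprM cn expr1n mul1r.
Qed.

(** The absolute value keeps exponents natural when [r < d]; it is harmless, since a power of [x] is
    1 iff its inverse is, and the gcd ignores signs too. *)
Lemma expr_absz_sub_eq1 (F : fieldType) (x : F) (r d : nat) :
  x != 0 -> (x ^+ `|r%:Z - d%:Z| == 1) = (x ^+ r == x ^+ d).
Proof.
move=> x0; wlog led : r d / (d <= r)%N.
  move=> W; have [/W//|/ltnW/W] := leqP d r.
  by rewrite -opprB abszN => ->; rewrite eq_sym.
rewrite subzn // absz_nat -{2}(subnK led) exprD.
by rewrite -[X in _ = (_ == X)]mul1r (inj_eq (mulIf (expf_neq0 d x0))).
Qed.

Lemma horner_recip_poly (F : fieldType) (d : nat) (h : {poly F}) (z : F) :
  (size h <= d.+1)%N -> z != 0 -> (recip_poly d h).[z^-1] * z ^+ d = h.[z].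
Proof.
move=> szh z0; rewrite (horner_coef_wide _ szh) /recip_poly horner_sum mulr_suml.
apply: eq_bigr => i _; rewrite hornerZ hornerXn -mulrA; congr (_ * _).
have: (i <= d)%N by rewrite -ltnS.
move: (nat_of_ord i) => k lid.
by rewrite -[in z ^+ d](subnK lid) exprD mulrA exprVn mulVf ?mul1r // expf_neq0.
Qed.

(** Evaluate the polynomial identity at [z^-1]: since [z ^+ Q = z^-1], the argument of [h] on the
    right becomes [z] again. *)
Lemma self_recip_horner (F : fieldType) (Q d : nat) (beta : F) (h : {poly F})
    (z : F) :
    (size h <= d.+1)%N -> recip_poly d h ^+ Q = beta *: (h \Po 'X^Q) ->
    z ^+ Q.+1 = 1 ->
  h.[z] ^+ Q * z ^+ d = beta * h.[z].
Proof.
move=> szh hrec zQ.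
have z0 : z != 0 by apply/eqP=> z0; move/eqP: zQ; rewrite z0 expr0n eq_sym oner_eq0.
have zQV : z ^+ Q = z^-1 by apply: (mulfI z0); rewrite -exprS zQ mulfV.
rewrite -{1}(@horner_recip_poly _ d h z szh z0) exprMn -horner_exp hrec.
rewrite hornerZ horner_comp hornerXn -mulrA exprVn zQV invrK.
by rewrite -exprM mulnC exprM zQV exprVn mulVf ?mulr1 // expf_neq0.
Qed.

(** In the cyclic group of order [m * n], an element [w ^+ i] killed by [n] has [i] divisible by
    [m]. *)
Lemma expr_eq1_surj (F : finFieldType) (m n : nat) (z : F) :
  (0 < n)%N -> #|F|.-1 = (m * n)%N -> z ^+ n = 1 -> exists2 u, u != 0 & u ^+ m = z.
Proof.
move=> n0 mn zn; have [w pw] := finField_prim_root F; rewrite mn in pw.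
have [|i Dz] := prim_rootP pw (_ : z ^+ (m * n) = 1).
  by rewrite mulnC exprM zn expr1n.
have: (m * n %| i * n)%N by rewrite (prim_order_dvd pw) exprM -Dz zn.
rewrite dvdn_pmul2r // => /dvdnP[k Dk].
exists (w ^+ k); last by rewrite Dz Dk exprM.
by rewrite expf_neq0 // (prim_root_eq0 pw) -lt0n (prim_order_gt0 pw).
Qed.

(** A primitive [n]-th root of unity of [F] stays primitive in [K], so its powers already exhaust
    the [n]-th roots there. *)
Lemma unity_root_in_finField (F : finFieldType) (K : fieldType)
    (iota : {rmorphism F -> K}) (n : nat) (z : K) :
  (n %| #|F|.-1)%N -> z ^+ n = 1 -> exists2 x, z = iota x & x ^+ n = 1.
Proof.
move=> dvn zn; have [w pw] := finField_prim_root F.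
have pwn := dvdn_prim_root pw dvn; set v := w ^+ _ in pwn.
have pin : n.-primitive_root (iota v) by rewrite fmorph_primitive_root.
have [i Dz] := prim_rootP pin zn; exists (v ^+ i); first by rewrite rmorphXn.
by rewrite exprAC (prim_expr_order pwn) expr1n.
Qed.

Lemma finField_prim_root_dvd (F : finFieldType) (n : nat) :
  (n %| #|F|.-1)%N -> exists x : F, n.-primitive_root x.
Proof.
have [w pw] := finField_prim_root F => /(dvdn_prim_root pw).
by exists (w ^+ (#|F|.-1 %/ n)).
Qed.

Theorem theorem5p1 (Q r d : nat) (F : finFieldType)
    (K : closedFieldType) (iota : {rmorphism F -> K})
    (beta : F) (h : {poly F})
    (hQ : prime_power Q) (cardF : #|F| = (Q ^ 2)%N)
    (clK : algebraic_closure iota)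
    (hr : (0 < r)%N)
    (hbeta : Q.+1.-unity_root beta)
    (hd : size h = d.+1) (h0 : h.[0] != 0)
    (hrecip : recip_poly d h ^+ Q = beta *: (h \Po 'X^Q)) :
  permutes ('X^r * (h \Po 'X^(Q - 1))) <->
  [/\ gcdn r (Q - 1) = 1%N,
      gcdz (r%:Z - d%:Z) (Q + 1)%N%:Z = 1
    & forall z : K, Q.+1.-unity_root z -> ~~ root (map_poly iota h) z].
Proof.
have Q1 : (1 < Q)%N.
  by have:= finNzRing_gt1 F; rewrite cardF; case: (Q) => [|[|]].
have cF : #|F|.-1 = ((Q - 1) * Q.+1)%N by rewrite cardF -subn1 -[Q.+1]addn1 -subn_sqr.
have cF' : ((Q - 1) * Q.+1).+1 = #|F| by rewrite -cF prednK // cardF expn_gt0 ltnW.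
have b0 : beta != 0.
  by apply: contraTneq hbeta => ->; rewrite unity_rootE expr0n eq_sym oner_eq0.
have Q_1 : (Q - 1).+1 = Q by rewrite subn1 prednK // ltnW.
set f := 'X^r * _.
have fE a : f.[a] = a ^+ r * h.[a ^+ (Q - 1)].
  by rewrite /f hornerM horner_comp !hornerXn.
have f0 : f.[0] = 0 by rewrite fE expr0n eqn0Ngt hr mul0r.
have muP (a : F) : a != 0 -> (a ^+ (Q - 1)) ^+ Q.+1 = 1.
  by move=> a0; apply: (mulfI a0); rewrite -exprM -exprS cF' expf_card mulr1.
(* The factor [z ^+ d] is kept on the left because [r - d] may be negative. *)
have fX (a : F) : a != 0 -> h.[a ^+ (Q - 1)] != 0 ->
    f.[a] ^+ (Q - 1) * (a ^+ (Q - 1)) ^+ d = beta * (a ^+ (Q - 1)) ^+ r.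
  move=> a0; rewrite fE; move: (muP a a0).
  set z := a ^+ (Q - 1) => zQ hz.
  have /(mulfI hz) <- : h.[z] * (h.[z] ^+ (Q - 1) * z ^+ d) = h.[z] * beta.
    by rewrite mulrA -exprS Q_1 (@self_recip_horner F Q d beta) ?hd // mulrC.
  by rewrite exprMn exprAC -/z -mulrA mulrC.
have gz : (gcdz (r%:Z - d%:Z) (Q + 1)%N%:Z = 1) <-> coprime `|r%:Z - d%:Z| Q.+1.
  by rewrite /gcdz addn1 absz_nat /coprime; split=> [[->]|/eqP->].
have rootE : (forall z : K, Q.+1.-unity_root z -> ~~ root (map_poly iota h) z)
    <-> (forall z : F, z ^+ Q.+1 = 1 -> h.[z] != 0).
  split=> [H z zQ|H z /unity_rootP zQ].
    have := H (iota z); rewrite fmorph_root; apply.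
    by apply/unity_rootP; rewrite -rmorphXn zQ rmorph1.
  have [|x -> xQ] := @unity_root_in_finField F K iota Q.+1 z _ zQ.
    by rewrite cF dvdn_mull.
  by rewrite fmorph_root; apply: H.
split=> [/bij_inj finj|[/eqP co_r /gz co_d /rootE hroot]]; last first.
  apply: injF_bij => a b.
  have f_eq0 x : f.[x] = 0 -> x = 0.
    move=> fx; apply: contraTeq isT => x0; move/eqP: fx.
    by rewrite fE mulf_eq0 expf_eq0 (negPf x0) andbF (negPf (hroot _ (muP x x0))).
  have [-> /esym|a0] := eqVneq a 0; first by rewrite f0 => /f_eq0.
  have [->|b0'] := eqVneq b 0; first by rewrite f0 => /f_eq0.
  move=> fab.
  have za := muP a a0; have zb := muP b b0'.
  have ha := hroot _ za; have hb := hroot _ zb.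
  have Ea := fX a a0 ha; have Eb := fX b b0' hb.
  (* Dividing the instances of [fX] at [a] and [b] cancels [beta] and the common value of [f], so
     the quotient [z / w] has equal [r]-th and [d]-th powers. *)
  have eqz : a ^+ (Q - 1) = b ^+ (Q - 1).
    have fa0 : f.[a] != 0 by apply: contraNneq a0 => /f_eq0->.
    move: Ea Eb (expf_neq0 (Q - 1) a0) (expf_neq0 (Q - 1) b0') za zb.
    rewrite -fab; move: (f.[a] ^+ _) (expf_neq0 (Q - 1) fa0) => c c0.
    move: (a ^+ _) (b ^+ _) => z w Ez Ew z0 w0 zQ wQ.
    apply: (divIf w0); rewrite divff //.
    apply: (@expr_coprime_eq1 F _ _ _ co_d); last by rewrite expr_div_n zQ wQ divr1.
    apply/eqP; rewrite expr_absz_sub_eq1 ?mulf_neq0 ?invr_neq0 // !expr_div_n.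
    rewrite eqr_div ?expf_neq0 //; apply/eqP/(mulfI (mulf_neq0 b0 c0)).
    by rewrite mulrACA -Ez Ew mulrACA [c * beta]mulrC.
  (* Now [h] takes the same nonzero value for [a] and [b], and cancels. *)
  have eqr : a ^+ r = b ^+ r.
    by apply: (mulIf ha); move: fab; rewrite !fE eqz.
  apply: (divIf b0'); rewrite divff //.
  apply: (@expr_coprime_eq1 F _ _ _ co_r); rewrite expr_div_n ?eqr ?eqz divff //;
    exact: expf_neq0.
(* A root [z = u ^+ (Q - 1)] would make [f] vanish at both [u] and 0. *)
have hroot (z : F) : z ^+ Q.+1 = 1 -> h.[z] != 0.
  move=> zQ; have [//|u u0 Du] := @expr_eq1_surj F _ _ _ _ cF zQ.
  apply: contraNneq u0 => hz; apply/eqP/finj.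
  by rewrite f0 fE Du hz mulr0.
have f_mul (e a : F) : e ^+ (Q - 1) = 1 -> f.[e * a] = e ^+ r * f.[a].
  by move=> eQ; rewrite !fE !exprMn eQ mul1r mulrA.
have co_r : coprime r (Q - 1).
  (* An element [x] whose order is the gcd satisfies [f.[x] = f.[1]], so that order is 1. *)
  have [|x px] := @finField_prim_root_dvd F (gcdn r (Q - 1)).
    by rewrite cF dvdn_mulr // dvdn_gcdr.
  have xr : x ^+ r = 1 by apply/eqP; rewrite -(prim_order_dvd px) dvdn_gcdl.
  have xQ : x ^+ (Q - 1) = 1 by apply/eqP; rewrite -(prim_order_dvd px) dvdn_gcdr.
  have x1 : x = 1.
    by apply: finj; rewrite -[x in LHS]mulr1 f_mul // xr mul1r.
  by apply/eqP/(@prim_root1 F); rewrite -x1.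
split; [exact/eqP | apply/gz | exact/rootE].
(* Again [x] has the gcd as its order; a preimage [u] of [x] under the power [Q - 1] is compared
   with 1, as [x ^+ r = x ^+ d] puts both values of [f] over [beta]. *)
have [|x px] := @finField_prim_root_dvd F (gcdn `|r%:Z - d%:Z| Q.+1).
  by rewrite cF dvdn_mull // dvdn_gcdr.
have xQ : x ^+ Q.+1 = 1 by apply/eqP; rewrite -(prim_order_dvd px) dvdn_gcdr.
have [//|u u0 Du] := @expr_eq1_surj F _ _ _ _ cF xQ.
have x0 : x != 0 by rewrite -Du expf_neq0.
have xrd : x ^+ r = x ^+ d.
  by apply/eqP; rewrite -expr_absz_sub_eq1 // -(prim_order_dvd px) dvdn_gcdl.
have fu : f.[u] ^+ (Q - 1) = beta.
  by apply: (mulIf (expf_neq0 d x0)); have := fX u u0; rewrite Du xrd => ->; rewrite ?hroot.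
have h1 : h.[1] != 0 by rewrite hroot ?expr1n.
have f1 : f.[1] ^+ (Q - 1) = beta.
  by have := fX 1 (oner_neq0 F); rewrite !expr1n !mulr1; apply.
have f1_0 : f.[1] != 0 by rewrite fE !expr1n mul1r.
(* The ratio has [(Q - 1)]-th power 1, hence is [e ^+ r] with [e ^+ (Q - 1) = 1]; then [f.[e] =
   f.[u]] forces [u = e] and [x = 1]. *)
have [|e eQ er] := @expr_coprime_surj F (f.[u] / f.[1]) _ _ hr co_r.
  by rewrite expr_div_n fu f1 divff.
have ue : u = e by apply: finj; rewrite -[e]mulr1 f_mul // er divfK.
by apply/eqP/(@prim_root1 F); rewrite -eQ -ue Du.
Qed.
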